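(* Let $T$ be a bounded linear operator defined on an infinite dimensional, separable $F$-space $X$. Then $T$ satisfies Kitai's Criterion if and only if $(X,T)$ is mixing and for every $x\in X$ the set $A_{\mathbb{N}}(x)$ is dense in $X$.
   Context: $\|\cdot\|$ denotes the $F$-norm of $X$ (so $(x,y)\mapsto\|x-y\|$ is a complete translation-invariant metric inducing the topology). $T$ satisfies Kitai's Criterion if there exist two dense subsets $D_1,D_2$ of $X$ and a sequence of mappings $S_n:D_2\to X$ ($n\in\mathbb{N}$; not assumed linear or continuous) such that, as $n\to\infty$: (i) $T^n x\to 0$ for every $x\in D_1$; (ii) $S_n y\to 0$ for every $y\in D_2$; (iii) $\|T^nS_ny-y\|\to 0$ for every $y\in D_2$. $(X,T)$ is mixing if for every pair of non-empty open sets $U,V\subset X$ there exists $N\in\mathbb{N}$ such that $T^n(U)\cap V\neq\emptyset$ for all $n\geq N$. For $x\in X$, $A_{\mathbb{N}}(x)=\{y\in X:\lim_{n\to\infty}\|T^n(x)-T^n(y)\|=0\}$ is the asymptotic cell of $x$. *)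

(* Defs.v *)
From HB Require Import structures.
From mathcomp Require Import all_boot all_order all_algebra.
From mathcomp Require Import all_classical all_reals all_analysis.
From mathcomp Require Import complex.

Set Implicit Arguments.
Unset Strict Implicit.
Unset Printing Implicit Defensive.

Import Order.TTheory GRing.Theory Num.Theory.
Import numFieldNormedType.Exports.

Local Open Scope classical_set_scope.
Local Open Scope ring_scope.

Variant scalar_kind := RealScalars | ComplexScalars.

Definition scalars (R : realType) (k : scalar_kind) : numFieldType :=
  match k with
  | RealScalars => R : numFieldType
  | ComplexScalars => R[i] : numFieldType
  end.

Record is_Fnorm (R : realType) (K : numFieldType) (X : lmodType K)
    (N : X -> R) : Prop := IsFnorm {
  Fnorm_ge0 : forall x, 0 <= N x;
  Fnorm_eq0 : forall x, N x = 0 <-> x = 0;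
  Fnorm_triangle : forall x y, N (x + y) <= N x + N y;
  Fnorm_scale_le : forall (a : K) x, `|a| <= 1 -> N (a *: x) <= N x;
  Fnorm_scale_cvg0 : forall x,
    N ((a : K) *: x) @[a --> (0 : K^o)] --> (0 : R)
}.

(* No local convexity is assumed, hence [topologicalLmodType] rather than
   [tvsType]. *)
Record is_Fspace (R : realType) (K : numFieldType) (X : topologicalLmodType K)
    (N : X -> R) : Prop := IsFspace {
  Fspace_norm : is_Fnorm N;
  Fspace_nbhs : forall (x : X) (A : set X),
    nbhs x A <-> exists2 e : R, 0 < e & [set y | N (x - y) < e] `<=` A;
  Fspace_complete : forall u : nat -> X,
    (forall e : R, 0 < e -> exists n0 : nat, forall m n : nat,
        (n0 <= m)%N -> (n0 <= n)%N -> N (u m - u n) < e) ->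
    exists l : X, u n @[n --> \oo] --> l
}.

Definition separable (X : topologicalType) : Prop :=
  exists2 D : set X, countable D & dense D.

Definition finite_dimensional (K : numFieldType) (X : lmodType K) : Prop :=
  exists (n : nat) (e : 'I_n -> X),
    forall x : X, exists c : 'I_n -> K, x = \sum_(i < n) c i *: e i.

(* Von Neumann boundedness. The inequality [0 < t < s] in [K] forces [s] and [t]
   to be real, also for complex scalars. Boundedness for the metric induced by
   an F-norm is a different, weaker notion. *)
Definition tvs_bounded (K : numFieldType) (X : topologicalLmodType K)
    (B : set X) : Prop :=
  forall U : set X, nbhs 0 U ->
    exists2 t : K, 0 < t & forall s : K, t < s -> B `<=` [set s *: u | u in U].

(* On an F-space this is equivalent to continuity. *)
Definition bounded_operator (K : numFieldType) (X : topologicalLmodType K)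
    (T : {linear X -> X}) : Prop :=
  forall B : set X, tvs_bounded B -> tvs_bounded (T @` B).

Definition Kitai_criterion (R : realType) (K : numFieldType)
    (X : topologicalLmodType K) (N : X -> R) (T : X -> X) : Prop :=
  exists (D1 D2 : set X) (S : nat -> D2 -> X),
    [/\ dense D1, dense D2,
        forall x : X, D1 x -> iter n T x @[n --> \oo] --> (0 : X),
        forall y : D2, S n y @[n --> \oo] --> (0 : X) &
        forall y : D2,
          N (iter n T (S n y) - val y) @[n --> \oo] --> (0 : R)].

Definition mixing (X : topologicalType) (T : X -> X) : Prop :=
  forall U V : set X, open U -> open V -> U !=set0 -> V !=set0 ->
    exists n0 : nat, forall n : nat, (n0 <= n)%N ->
      (iter n T @` U) `&` V !=set0.

Definition asymptotic_cell (R : realType) (K : numFieldType) (X : lmodType K)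
    (N : X -> R) (T : X -> X) (x : X) : set X :=
  [set y | N (iter n T x - iter n T y) @[n --> \oo] --> (0 : R)].

(* Main.v *)
(** Given Kitai's Criterion, the asymptotic cell of [x] contains [x - D1], and
    [u + S n v] witnesses mixing for [u] in [D1] and [v] in [D2]. Conversely,
    take for [D1] the asymptotic cell of [0] and for [D2] the whole space:
    mixing says that [inf_x N x + N (T^n x - y)] tends to [0] for every [y],
    and [S n y] is a point attaining this infimum up to [1 / (n + 1)]. *)
Require Import Defs.
From HB Require Import structures.
From mathcomp Require Import all_boot all_order all_algebra.
From mathcomp Require Import all_classical all_reals all_analysis.
Import Order.TTheory GRing.Theory Num.Theory.
Import numFieldNormedType.Exports.
Local Open Scope classical_set_scope.
Local Open Scope ring_scope.

Set Implicit Arguments.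
Unset Strict Implicit.

Lemma iter_linearD (K : numFieldType) (X : lmodType K) (T : {linear X -> X})
    (n : nat) : {morph iter n T : x y / x + y}.
Proof. by elim: n => [//|n IHn] x y /=; rewrite IHn linearD. Qed.

Lemma iter_linearB (K : numFieldType) (X : lmodType K) (T : {linear X -> X})
    (n : nat) : {morph iter n T : x y / x - y}.
Proof. by elim: n => [//|n IHn] x y /=; rewrite IHn linearB. Qed.

Lemma iter_linear0 (K : numFieldType) (X : lmodType K) (T : {linear X -> X})
    (n : nat) : iter n T 0 = 0.
Proof. by elim: n => [//|n /= ->]; rewrite linear0. Qed.

Lemma FnormN (R : realType) (K : numFieldType) (X : lmodType K) (N : X -> R)
    (HN : is_Fnorm N) (x : X) : N (- x) = N x.
Proof.
have le_opp z : N (- z) <= N z.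
  by rewrite -scaleN1r; apply: (Fnorm_scale_le HN); rewrite normrN1.
by apply/eqP; rewrite eq_le le_opp -{1}(opprK x) le_opp.
Qed.

Lemma Fnorm_distC (R : realType) (K : numFieldType) (X : lmodType K)
    (N : X -> R) (HN : is_Fnorm N) (x y : X) : N (x - y) = N (y - x).
Proof. by rewrite -opprB FnormN. Qed.

Lemma Fspace_nbhs_ball (R : realType) (K : numFieldType)
    (X : topologicalLmodType K) (N : X -> R) (HX : is_Fspace N) (x : X) (e : R) :
  0 < e -> nbhs x [set y | N (x - y) < e].
Proof. by move=> e0; apply/(Fspace_nbhs HX); exists e. Qed.

Lemma Fspace_cvgP (R : realType) (K : numFieldType)
    (X : topologicalLmodType K) (N : X -> R) (HX : is_Fspace N)
    (u : nat -> X) (l : X) :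
  u n @[n --> \oo] --> l <-> N (u n - l) @[n --> \oo] --> (0 : R).
Proof.
have HN := Fspace_norm HX; split => [ul|ul].
  apply/cvgr0Pnorm_lt => e e0.
  have ule : \forall n \near \oo, N (l - u n) < e.
    exact: ul _ (Fspace_nbhs_ball HX l e0).
  apply: filterS ule => n /= lt_e.
  by rewrite ger0_norm ?(Fnorm_ge0 HN)// Fnorm_distC.
move=> A /(Fspace_nbhs HX)[e e0 sub_A].
have ule : \forall n \near \oo, `|N (u n - l)| < e by move/cvgr0Pnorm_lt: ul; exact.
apply: (filterS _ ule) => n /= lt_e.
by apply: sub_A => /=; rewrite Fnorm_distC//; apply: le_lt_trans lt_e; exact: ler_norm.
Qed.

Lemma Fspace_denseP (R : realType) (K : numFieldType)
    (X : topologicalLmodType K) (N : X -> R) (HX : is_Fspace N) (D : set X) :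
  dense D <-> forall (x : X) (e : R), 0 < e -> exists2 y, D y & N (x - y) < e.
Proof.
split=> [dD x e e0|dD O [x Ox] oO].
  (* [Fspace_nbhs] makes a ball a neighbourhood of its centre but does not say that it is open. Its
     interior is open and still contains the centre, so density applies there. *)
  have [|y [/interior_subset xy Dy]] :=
      dD (interior [set y | N (x - y) < e]) _ (@open_interior _ _).
    by exists x; exact: Fspace_nbhs_ball.
  by exists y.
have /(Fspace_nbhs HX)[e e0 sub_O] := open_nbhs_nbhs (conj oO Ox).
by have [y Dy xy] := dD x e e0; exists y; split=> //; exact: sub_O.
Qed.

Lemma Fspace_mixingP (R : realType) (K : numFieldType)
    (X : topologicalLmodType K) (N : X -> R) (HX : is_Fspace N) (T : X -> X) :
  mixing T <-> forall (x y : X) (e : R), 0 < e ->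
    \forall n \near \oo, exists2 z, N (x - z) < e & N (y - iter n T z) < e.
Proof.
split=> [mT x y e e0|mT U V oU oV [x Ux] [y Vy]].
  have ball_neq0 z : interior [set w | N (z - w) < e] !=set0.
    by exists z; exact: Fspace_nbhs_ball.
  have [n0 meet] := mT _ _ (@open_interior _ _) (@open_interior _ _)
    (ball_neq0 x) (ball_neq0 y).
  exists n0 => // n /= /meet[_ [[z /interior_subset xz <-] /interior_subset yz]].
  by exists z.
have /(Fspace_nbhs HX)[e e0 sub_U] := open_nbhs_nbhs (conj oU Ux).
have /(Fspace_nbhs HX)[f f0 sub_V] := open_nbhs_nbhs (conj oV Vy).
(* The two open sets come with different radii; the smaller one serves for both. *)
have [|n0 _ near_z] := mT x y (Num.min e f); first by rewrite lt_min e0 f0.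
exists n0 => n /near_z[z]; rewrite !lt_min => /andP[xz _] /andP[_ yz].
by exists (iter n T z); split; [exists z => //; exact: sub_U|exact: sub_V].
Qed.

Lemma Kitai_mixing (R : realType) (K : numFieldType)
    (X : topologicalLmodType K) (N : X -> R) (HX : is_Fspace N)
    (T : {linear X -> X}) :
  Kitai_criterion N T -> mixing T.
Proof.
move=> [D1 [D2 [S [/(Fspace_denseP HX) dD1 /(Fspace_denseP HX) dD2 T0 S0 TS]]]].
have HN := Fspace_norm HX.
apply/(Fspace_mixingP HX) => x y e e0.
(* The distance from [y] to the iterate of [u + S n v'] splits into three errors, and that from [x]
   to [u + S n v'] into two. *)
have e3 : 0 < e / 3%:R by rewrite divr_gt0.
have e3_sum : e / 3%:R + (e / 3%:R + e / 3%:R) = e.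
  by rewrite addrA -mulr2n -mulrSr -[LHS]mulr_natr divfK.
have [u D1u xu] := dD1 x _ e3; have [v D2v yv] := dD2 y _ e3.
pose v' : D2 := SigSub (mem_set D2v).
have /(Fspace_cvgP HX)/cvgr0Pnorm_lt/(_ _ e3) Tu := T0 _ D1u.
have /(Fspace_cvgP HX)/cvgr0Pnorm_lt/(_ _ e3) Sv := S0 v'.
have /cvgr0Pnorm_lt/(_ _ e3) TSv := TS v'.
near=> n.
have Tu_lt : N (iter n T u) < e / 3%:R.
  by apply: le_lt_trans (ler_norm _) _; rewrite -[iter _ _ _]subr0; near: n.
have Sv_lt : N (S n v') < e / 3%:R.
  by apply: le_lt_trans (ler_norm _) _; rewrite -[S _ _]subr0; near: n.
have TSv_lt : N (iter n T (S n v') - v) < e / 3%:R.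
  by apply: le_lt_trans (ler_norm _) _; near: n.
exists (u + S n v').
  rewrite opprD addrA (le_lt_trans (Fnorm_triangle HN _ _))//.
  rewrite FnormN// -e3_sum ltrD// (lt_trans Sv_lt)// ltrDl//.
(* The three errors come from the density of [D2], from the orbit of [u] tending to 0, and from
   [S n] being asymptotically a right inverse of the [n]-th iterate. *)
have -> : y - iter n T (u + S n v') =
    (y - v) + (- iter n T u + (v - iter n T (S n v'))).
  by rewrite iter_linearD opprD addrCA [RHS]addrCA subrKA.
rewrite -e3_sum (le_lt_trans (Fnorm_triangle HN _ _))// ltrD//.
rewrite (le_lt_trans (Fnorm_triangle HN _ _))// ltrD// ?FnormN//.
by rewrite Fnorm_distC.
Unshelve. all: by end_near. Qed.

Lemma Kitai_dense_asymptotic_cell (R : realType) (K : numFieldType)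
    (X : topologicalLmodType K) (N : X -> R) (HX : is_Fspace N)
    (T : {linear X -> X}) (x : X) :
  Kitai_criterion N T -> dense (asymptotic_cell N T x).
Proof.
move=> [D1 [_ [_ [/(Fspace_denseP HX) dD1 _ T0 _ _]]]].
apply/(Fspace_denseP HX) => y e e0.
(* If [d] is close to [x - y], then [x - d] is equally close to [y]; by linearity the orbits of [x]
   and [x - d] differ by the orbit of [d], which tends to 0. *)
have [d D1d xyd] := dD1 (x - y) e e0.
exists (x - d); last first.
  by rewrite -(FnormN (Fspace_norm HX)) opprB addrAC.
have /(Fspace_cvgP HX) := T0 _ D1d; apply: cvg_trans.
apply: near_eq_cvg; near=> n.
by rewrite -iter_linearB subr0 opprB addrC subrK.
Unshelve. all: by end_near. Qed.

(** The rank from which mixing provides a good point depends on [e] and [y]. A near-minimiser of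
    [cost n y] is chosen without reference to [e], so a single sequence works for every [e] and no
    diagonal argument arises. *)
Lemma mixing_approximate_right_inverse (R : realType) (K : numFieldType)
    (X : topologicalLmodType K) (N : X -> R) (HX : is_Fspace N) (T : X -> X) :
  mixing T -> exists S : nat -> X -> X, forall y : X,
    S n y @[n --> \oo] --> (0 : X) /\
    N (iter n T (S n y) - y) @[n --> \oo] --> (0 : R).
Proof.
move=> /(Fspace_mixingP HX) mT; have HN := Fspace_norm HX.
pose cost n y x := N x + N (iter n T x - y).
have cost_ge0 n y x : 0 <= cost n y x by rewrite addr_ge0 ?(Fnorm_ge0 HN).
have has_inf_cost n y : has_inf (range (cost n y)).
  split; first by exists (cost n y 0), 0.
  by exists 0 => _ [x _ <-].
(* The infimum need not be attained, so a slack is allowed: it is positive for every [n], including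
   0, and vanishes in the limit. Choosing over pairs yields all the maps at once. *)
have [S S_inf] : {S : nat * X -> X & forall p,
    cost p.1 p.2 (S p) < inf (range (cost p.1 p.2)) + p.1.+1%:R^-1}.
  apply: (@choice _ _ (fun p x =>
    cost p.1 p.2 x < inf (range (cost p.1 p.2)) + p.1.+1%:R^-1)) => p.
  have [|_ [x _ <-] lt_x] := @inf_adherent _ _ p.1.+1%:R^-1 _ (has_inf_cost p.1 p.2).
    by rewrite invr_gt0.
  by exists x.
exists (fun n y => S (n, y)) => y.
have cost0 : cost n y (S (n, y)) @[n --> \oo] --> (0 : R).
  apply/cvgr0Pnorm_lt => e e0.
  have e3 : 0 < e / 3%:R by rewrite divr_gt0.
  have e3_sum : e / 3%:R + e / 3%:R + e / 3%:R = e.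
    by rewrite -mulr2n -mulrSr -[LHS]mulr_natr divfK.
  near=> n; rewrite ger0_norm//; apply: lt_trans (S_inf (n, y)) _ => /=.
  rewrite -e3_sum ltrD//; last by near: n; exact: near_infty_natSinv_lt (PosNum e3).
  (* Mixing between the points 0 and [y] gives a competitor [z] that bounds the infimum by two
     thirds of [e]; the slack takes the last third. *)
  have [z] : exists2 z, N (0 - z) < e / 3%:R & N (y - iter n T z) < e / 3%:R.
    by near: n; exact: mT.
  rewrite sub0r FnormN// Fnorm_distC// => z0 zy.
  apply: le_lt_trans (ltrD z0 zy).
  by apply: ge_inf; [case: (has_inf_cost n y)|exists z].
split.
  (* Both summands of [cost] are nonnegative, so each is squeezed between 0 and the cost. *)
  apply/(Fspace_cvgP HX); apply: squeeze_cvgr cost0; last exact: cvg_cst.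
  by near=> n; rewrite (Fnorm_ge0 HN)//= subr0 lerDl (Fnorm_ge0 HN).
apply: squeeze_cvgr cost0; last exact: cvg_cst.
by near=> n; rewrite (Fnorm_ge0 HN)//= lerDr (Fnorm_ge0 HN).
Unshelve. all: by end_near. Qed.

Unset Implicit Arguments.
Set Strict Implicit.

Theorem corollary3p13 (R : realType) (k : scalar_kind)
    (X : topologicalLmodType (scalars R k)) (N : X -> R)
    (HX : is_Fspace N) (Hsep : separable X) (Hinf : ~ finite_dimensional X)
    (T : {linear X -> X}) (HT : bounded_operator T) :
  Kitai_criterion N T <->
  mixing T /\ (forall x : X, dense (asymptotic_cell N T x)).
Proof.
split=> [KT|[/(mixing_approximate_right_inverse HX)[S ST] dA]].
  by split=> [|x]; [exact: Kitai_mixing KT|exact: Kitai_dense_asymptotic_cell].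
(* Since linear iterates fix 0, the cell of 0 consists of the points whose orbit tends to 0. *)
exists (asymptotic_cell N T 0), [set: X], (fun n y => S n (val y)); split.
- exact: dA.
- by move=> O O0 _; rewrite setIT.
- move=> x /= T0; apply/(Fspace_cvgP HX); apply: cvg_trans T0.
  apply: near_eq_cvg; near=> n.
  by rewrite iter_linear0 Fnorm_distC//; exact: Fspace_norm.
- by move=> y; have [] := ST (val y).
- by move=> y; have [] := ST (val y).
Unshelve. all: by end_near. Qed.
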